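(* For every positive integer $n$ there exists a finite simple graph $G$ which is 2-connected and prime with respect to the Cartesian product, and such that $m_G(1)\ge n$.
   Context: For a finite simple graph $G$, $L(G)=D(G)-A(G)$ is its Laplacian matrix (degree diagonal matrix minus adjacency matrix), and $m_G(\lambda)$ denotes the multiplicity of $\lambda$ as an eigenvalue of $L(G)$. A graph is $t$-connected if removing fewer than $t$ vertices never leaves a disconnected or trivial graph. A graph is prime with respect to the Cartesian product if it is not isomorphic to a Cartesian product $G_1\,\square\, G_2$ of two graphs each having at least two vertices. *)

(* Defs.v *)
From mathcomp Require Import all_boot all_order all_algebra.
Set Implicit Arguments. Unset Strict Implicit. Unset Printing Implicit Defensive.
Import GRing.Theory.
Local Open Scope ring_scope.

Record sgraph := SGraph {
  vertex :> finType;
  adj : rel vertex;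
  adj_sym : symmetric adj;
  adj_irr : irreflexive adj }.

Section Induced.
Variables (G : sgraph) (A : {set G}).

Definition induced_adj : rel {x : G | x \in A} :=
  fun x y => adj (val x) (val y).

Lemma induced_adj_sym : symmetric induced_adj.
Proof. by move=> x y; rewrite /induced_adj adj_sym. Qed.

Lemma induced_adj_irr : irreflexive induced_adj.
Proof. by move=> x; rewrite /induced_adj adj_irr. Qed.

Definition induced : sgraph := SGraph induced_adj_sym induced_adj_irr.
End Induced.

Definition connected_graph (G : sgraph) : Prop :=
  forall x y : G, connect (@adj G) x y.

(* The null graph counts as trivial, so no t-connected graph (t > 0) is empty. *)
Definition trivial_graph (G : sgraph) : Prop := (#|G| <= 1)%N.

Definition t_connected (t : nat) (G : sgraph) : Prop :=
  forall S : {set G}, (#|S| < t)%N ->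
    connected_graph (induced (~: S)) /\ ~ trivial_graph (induced (~: S)).

Section CartesianProduct.
Variables G1 G2 : sgraph.

Definition cart_adj : rel (G1 * G2)%type := fun u v =>
  (u.1 == v.1) && adj u.2 v.2 || (u.2 == v.2) && adj u.1 v.1.

Lemma cart_adj_sym : symmetric cart_adj.
Proof.
move=> u v; rewrite /cart_adj (eq_sym u.1) (eq_sym u.2).
by rewrite (adj_sym u.2) (adj_sym u.1).
Qed.

Lemma cart_adj_irr : irreflexive cart_adj.
Proof. by move=> u; rewrite /cart_adj !adj_irr !andbF. Qed.

Definition cart_prod : sgraph := SGraph cart_adj_sym cart_adj_irr.
End CartesianProduct.

Definition graph_iso (G H : sgraph) : Prop :=
  exists2 f : G -> H, bijective f & forall x y, adj (f x) (f y) = adj x y.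

Definition cart_prime (G : sgraph) : Prop :=
  ~ exists G1 G2 : sgraph,
      [/\ (2 <= #|G1|)%N, (2 <= #|G2|)%N & graph_iso G (cart_prod G1 G2)].

Definition degree (G : sgraph) (x : G) : nat := #|[set y | adj x y]|.

Section Laplacian.
Variables (R : pzRingType) (G : sgraph).

(* Rows and columns are indexed by the enumeration of the vertices of G. *)
Definition degree_mx : 'M[R]_#|G| := diag_mx (\row_i (degree (enum_val i))%:R).

Definition adjacency_mx : 'M[R]_#|G| :=
  \matrix_(i, j) (adj (enum_val i) (enum_val j))%:R.

Definition laplacian : 'M[R]_#|G| := degree_mx - adjacency_mx.
End Laplacian.

(* The dimension of the eigenspace: it equals the multiplicity of a as a root
   of the characteristic polynomial, since the Laplacian is real symmetric. *)
Definition eigen_mult (R : rcfType) (G : sgraph) (a : R) : nat :=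
  \rank (eigenspace (laplacian R G) a).

(* Main.v *)
Require Import Defs.
From mathcomp Require Import all_boot all_order all_algebra.
Import GRing.Theory.
Local Open Scope ring_scope.

(** Take two hubs joined by [n.+1] internally disjoint paths of length 3. A
function that vanishes at the hubs and is constant on the two inner vertices of
each path is an eigenvector of the Laplacian for the eigenvalue 1 as soon as its
values on the paths sum to 0; such functions form a space of dimension [n].
The graph is prime because it has no 4-cycle, whereas every edge of a connected
Cartesian product of nontrivial factors lies in one. *)

Lemma connected_invariant (G : sgraph) (P : pred G) (x : G) :
    (forall y z : G, connect (@adj G) y z) ->
    (forall y z : G, adj y z -> P y -> P z) ->
  P x -> forall y, P y.
Proof.
move=> conG closP Px y; have /connectP[p] := conG x y.
elim: p x Px => [|z p IHp] x Px /=; first by move=> _ ->.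
by case/andP=> xz; apply: IHp; apply: closP xz Px.
Qed.

Lemma card_gt1_neq (T : finType) (x : T) : (2 <= #|T|)%N -> exists y, y != x.
Proof.
case/card_gt1P=> y [z [_ _ yz]]; have [yx|] := eqVneq y x; last by exists y.
by exists z; rewrite -yx eq_sym.
Qed.

(** Deleting the empty set leaves a copy of [G] on a subtype; its paths are carried back to [G]. *)
Lemma t_connected_connected (t : nat) (G : sgraph) :
  t_connected t.+1 G -> connected_graph G.
Proof.
move=> /(_ set0); rewrite cards0 => /(_ isT)[conH _] x y.
have in0 (z : G) : z \in ~: set0 by rewrite !inE.
pose P (z : induced (~: set0 : {set G})) := connect (@adj G) x (val z).
have := connected_invariant _ P (Sub x (in0 x)) conH.
move/(_ _ _ (Sub y (in0 y))); apply; last exact: connect0.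
by move=> a b ab xa; apply: connect_trans xa (connect1 _).
Qed.

(** A single edge in no 4-cycle suffices. In a product the edge changes one coordinate only, and a
    step in the other coordinate, made at both ends, completes a square. *)
Lemma cart_prime_edge (G : sgraph) (u v : G) :
    (forall x y : G, connect (@adj G) x y) -> adj u v ->
    (forall z w : G, adj u z -> adj z w -> adj w v -> z != v -> w != u -> False) ->
  cart_prime G.
Proof.
move=> conG uv no4 [G1 [G2 [card1 card2 [f [g fK gK] fadj]]]].
have square z w : adj (f u) z -> adj z w -> adj w (f v) -> z != f v -> w != f u -> False.
  rewrite -[z]gK -[w]gK !fadj !(inj_eq (can_inj fK)); exact: no4.
move: uv; rewrite -fadj; case fu: (f u) (f v) square => [x y] [x' y'] square.
case/orP=> /= /andP[/eqP eqx adjx].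
- have [/existsP[x1 xx1]|/existsPn isol] := boolP [exists z, adj x z].
    have nx : x1 != x by apply: contraTneq xx1 => ->; rewrite adj_irr.
    apply: (square (x1, y) (x1, y')); rewrite -?eqx /= /cart_adj /= ?eqxx ?xx1 ?adjx ?orbT //.
    - by rewrite adj_sym xx1 orbT.
    - by rewrite xpair_eqE negb_and nx.
    - by rewrite xpair_eqE negb_and nx.
  (* If [x] is isolated in [G1], no edge leaves the fibre over [x], so connectedness puts every
     vertex in it, against the choice of [x2]. *)
  have [x2 /eqP[]] := card_gt1_neq _ x card1.
  suff /(_ (g (x2, y))) : forall z, (f z).1 == x by rewrite gK => /eqP.
  apply: (connected_invariant _ _ u conG); last by rewrite fu.
  move=> a b; rewrite -fadj /= /cart_adj => /orP[/andP[/eqP-> //]|/andP[_ ab] /eqP ax].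
  by have := isol (f b).1; rewrite -ax ab.
have [/existsP[y1 yy1]|/existsPn isol] := boolP [exists z, adj y z].
  have ny : y1 != y by apply: contraTneq yy1 => ->; rewrite adj_irr.
  apply: (square (x, y1) (x', y1)); rewrite -?eqx /= /cart_adj /= ?eqxx ?yy1 ?adjx ?orbT //.
  - by rewrite adj_sym yy1.
  - by rewrite xpair_eqE negb_and ny orbT.
  - by rewrite xpair_eqE negb_and ny orbT.
have [y2 /eqP[]] := card_gt1_neq _ y card2.
suff /(_ (g (x, y2))) : forall z, (f z).2 == y by rewrite gK => /eqP.
apply: (connected_invariant _ _ u conG); last by rewrite fu.
move=> a b; rewrite -fadj /= /cart_adj => /orP[/andP[_ ab] /eqP ay|/andP[/eqP-> //]].
by have := isol (f b).2; rewrite -ay ab.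
Qed.

Lemma laplacian_eigenvectors (R : fieldType) (G : sgraph) (a : R) (m : nat)
    (f : 'I_m -> G -> R) :
    (forall i x, \sum_(y | adj x y) (f i x - f i y) = a * f i x) ->
  (\matrix_(i < m, j < #|G|) f i (enum_val j) <= eigenspace (laplacian R G) a)%MS.
Proof.
move=> fa; apply/eigenspaceP/matrixP => i j; rewrite !mxE -fa.
under eq_bigr do rewrite !mxE mulrBr.
rewrite sumrB (bigD1 j) //= eqxx mulr1n big1 ?addr0; last first.
  by move=> k /negPf ->; rewrite mulr0n mulr0.
rewrite sumrB sumr_const /degree cardsE mulr_natr; congr (_ - _).
(* [eigenspace] consists of row vectors acting from the left, so the sum runs down a column;
   symmetry of adjacency turns it into a sum over neighbours. *)
rewrite [RHS]big_mkcond (reindex _ (onW_bij _ (enum_val_bij G))) /=.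
by apply: eq_bigr => k _; rewrite adj_sym; case: (adj _ _); rewrite ?mulr1 ?mulr0.
Qed.

Section Theta.
Variable k : nat.

(* [(c, None)] is a hub, and [(c, Some i)] is the inner vertex of the [i]-th path
   that is next to the hub [(c, None)]. *)
Definition theta_adj : rel (bool * option 'I_k) := fun u v =>
  match u.2, v.2 with
  | None, None => false
  | Some i, Some j => (i == j) && (u.1 != v.1)
  | _, _ => u.1 == v.1
  end.

Lemma theta_adj_sym : symmetric theta_adj.
Proof.
by move=> [c [i|]] [d [j|]]; rewrite /theta_adj //= [c == d]eq_sym // [i == j]eq_sym.
Qed.

Lemma theta_adj_irr : irreflexive theta_adj.
Proof. by move=> [c [i|]]; rewrite /theta_adj /= ?eqxx. Qed.

Definition theta : sgraph := SGraph theta_adj_sym theta_adj_irr.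

Lemma theta_t_connected : (1 < k)%N -> t_connected 2 theta.
Proof.
move=> k_gt1 S; rewrite ltnS => /card_le1_eqP S1.
pose H := induced (~: S).
pose sub (x : theta) (xS : x \in ~: S) : H := exist _ x xS.
have symH : connect_sym (@adj H) by apply: sym_connect_sym; apply: adj_sym.
pose i0 : 'I_k := Ordinal (ltnW k_gt1); pose i1 : 'I_k := Ordinal k_gt1.
have notS x y : x \in S -> y != x -> y \in ~: S.
  by move=> xS; rewrite inE; apply: contraNN => yS; apply/eqP/S1.
have to_hub (h : H) : (forall x : H, connect (@adj H) x h) -> connected_graph H.
  by move=> hubP x y; apply: connect_trans (hubP x) _; rewrite symH.
have step (x y : H) : theta_adj (val x) (val y) -> connect (@adj H) x y.
  by move=> xy; apply: connect1.
have nontriv : ~ trivial_graph H.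
  have : (#|S| <= 1)%N by apply/card_le1_eqP.
  have cardH : #|H| = (#|theta| - #|S|)%N.
    by rewrite card_sig -[in RHS](setCK S) -cardsCs; apply: eq_card => v; rewrite inE.
  rewrite /trivial_graph cardH card_prod card_bool card_option card_ord leq_subLR => leS.
  apply/negP; rewrite -ltnNge addn1 (leq_ltn_trans (_ : _ <= 2)%N) // ltn_Pmulr //.
  exact: ltnW.
split=> {nontriv}//.
(* If a hub is deleted, everything else survives and reaches the other hub in at most two steps. *)
case: (boolP [exists c, (c, None) \in S]) => [/existsP[c cS]|/existsPn hubs].
  have hS : (~~ c, None) \in ~: S by apply: notS cS _; case: (c).
  have inner d i : (d, Some i) \in ~: S by apply: notS cS _; rewrite xpair_eqE andbF.
  apply: (to_hub (sub _ hS)) => -[[d [i|]] dS]; last first.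
    have [dc|dc] := eqVneq d (~~ c).
      by apply: eq_connect0; apply: val_inj; rewrite /= dc.
    by exfalso; move: dS cS dc; rewrite inE; case: d c {hS inner} => -[] //= /negP.
  apply: (@connect_trans _ _ (sub _ (inner (~~ c) i))); last first.
    by apply: step; rewrite /theta_adj /=.
  have [dc|dc] := eqVneq d (~~ c).
    by apply: eq_connect0; apply: val_inj; rewrite /= dc.
  by apply: step; rewrite /theta_adj /= eqxx.
have hub c : (c, None) \in ~: S by rewrite inE hubs.
(* Both hubs survive. One deleted vertex cannot meet both paths [i0] and [i1], so an intact path
   joins the hubs, and each remaining inner vertex is next to its own hub. *)
have [i iS] : exists i, forall c, (c, Some i) \in ~: S.
  case: (boolP [exists c, (c, Some i0) \in S]) => [/existsP[c cS]|/existsPn i0S].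
    by exists i1 => d; apply: notS cS _; rewrite xpair_eqE andbF.
  by exists i0 => c; rewrite inE i0S.
have to_inner c : connect (@adj H) (sub _ (hub c)) (sub _ (iS c)).
  by apply: step; rewrite /theta_adj /=.
have hubP c : connect (@adj H) (sub _ (hub c)) (sub _ (hub true)).
  apply: connect_trans (to_inner c) _; rewrite symH.
  apply: connect_trans (to_inner true) _.
  have [dc|dc] := eqVneq c true.
    by apply: eq_connect0; apply: val_inj; rewrite /= dc.
  by apply: step; rewrite /theta_adj /= eqxx eq_sym.
apply: (to_hub (sub _ (hub true))) => -[[d o] dS].
apply: connect_trans (hubP d); case: o dS => [j|] dS; last first.
  by apply: eq_connect0; apply: val_inj.
by apply: step; rewrite /theta_adj /=.
Qed.

(** The middle edge of a path lies in no 4-cycle: the other neighbours of its ends are the two hubs,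
    which are not adjacent. *)
Lemma theta_cart_prime : (1 < k)%N -> cart_prime theta.
Proof.
move=> k_gt1; pose i : 'I_k := Ordinal k_gt1.
apply: (@cart_prime_edge theta (true, Some i) (false, Some i)).
- exact: t_connected_connected (theta_t_connected k_gt1).
- by rewrite /= /theta_adj /=.
move=> [c [j|]] [d [l|]]; rewrite /= /theta_adj //= !xpair_eqE.
- by case/andP=> /eqP <-; case: c; rewrite //= eqxx.
- by case/andP=> /eqP <-; case: c; rewrite //= eqxx.
- by move=> /eqP <- /eqP <- /andP[/eqP -> _] _; rewrite !eqxx.
Qed.

Lemma theta_eigenfunction (R : pzRingType) (g : 'I_k -> R) (x : theta) :
    \sum_i g i = 0 ->
  let f (v : theta) := oapp g 0 v.2 in
  \sum_(y | adj x y) (f x - f y) = f x.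
Proof.
move=> g0 f; case: x => c [i|].
  (* An inner vertex has two neighbours: the hub, of value 0, contributes [f x], and the other inner
     vertex of the path contributes 0. *)
  rewrite (bigD1 (c, None)) /=; last by rewrite /theta_adj /=.
  rewrite (bigD1 (~~ c, Some i)) /=; last by rewrite /theta_adj /= eqxx; case: (c).
  rewrite {}/f /= subrr subr0 add0r big1 ?addr0 // => -[d [j|]]; rewrite /theta_adj /=.
    by rewrite !xpair_eqE; case: eqP => [[<-]|//]; rewrite eqxx; case: c d => -[].
  by case: eqP => [->|//]; rewrite eqxx.
(* The neighbours of a hub are indexed by the paths. *)
rewrite (reindex_omap (fun i : 'I_k => (c, Some i)) snd) /=; last first.
  by case=> d [j|]; rewrite /theta_adj //= => /eqP->.
transitivity (- \sum_i g i); last by rewrite g0 oppr0.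
rewrite -sumrN; apply: eq_big => j; rewrite /theta_adj /= ?eqxx // => _.
by rewrite sub0r.
Qed.

End Theta.

Theorem theorem1p1 (R : rcfType) (n : nat) (hn : (0 < n)%N) :
  exists G : sgraph,
    [/\ t_connected 2%N G, cart_prime G & (n <= eigen_mult G (1 : R))%N].
Proof.
have k_gt1 : (1 < n.+1)%N by [].
exists (theta n.+1); split; [exact: theta_t_connected | exact: theta_cart_prime |].
(* A basis of the vectors of sum 0: value 1 on path [i + 1], -1 on path 0. *)
pose g (i : 'I_n) (j : 'I_n.+1) : R := (j == lift ord0 i)%:R - (j == ord0)%:R.
have g0 i : \sum_j g i j = 0.
  have delta (l : 'I_n.+1) : \sum_j (j == l)%:R = 1 :> R.
    by rewrite (bigD1 l) //= eqxx big1 ?addr0 // => j /negPf->.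
  by rewrite sumrB !delta subrr.
pose f i (v : theta n.+1) := oapp (g i) 0 v.2.
pose B := \matrix_(i < n, j < #|theta n.+1|) f i (enum_val j).
have sub : (B <= eigenspace (laplacian R (theta n.+1)) 1)%MS.
  by apply: laplacian_eigenvectors => i x; rewrite mul1r; apply: theta_eigenfunction.
suff /eqP rankB : row_free B by apply: leq_trans (mxrankS sub); rewrite rankB.
apply/row_freeP.
(* The right inverse evaluates at one inner vertex of each path other than path 0, where the [g i]
   restrict to the standard basis. *)
exists (\matrix_(j, i) (enum_val j == (true, Some (lift ord0 i)))%:R).
apply/matrixP=> i l; rewrite !mxE.
rewrite (bigD1 (enum_rank ((true, Some (lift ord0 l)) : theta n.+1))) //=.
rewrite !mxE enum_rankK eqxx mulr1 big1 ?addr0.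
  by rewrite /f /g /= subr0 (inj_eq lift_inj) eq_sym.
move=> j jl; rewrite !mxE; case: (enum_val j =P _) => [jv|_]; last by rewrite mulr0.
by rewrite -jv enum_valK eqxx in jl.
Qed.
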